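(* Let $H:\mathbb{R}^n\times\mathbb{R}^n\to\mathbb{R}$ be continuous and assume: (1) there is $C_1>0$ with $H(x,p)\ge -C_1$ for all $(x,p)\in\mathbb{R}^n\times\mathbb{R}^n$; (2) there is $C_2>0$ with $\sup_{x\in\mathbb{R}^n}|H(x,0)|\le C_2$; (3) for every $R>0$ there is a nondecreasing function $\omega_R:[0,\infty)\to[0,\infty)$ with $\omega_R(0^+)=0$ such that $|H(x,p)-H(y,p)|\le\omega_R(|x-y|)$ and $|H(x,p)-H(x,q)|\le\omega_R(|p-q|)$ for all $x,y\in\mathbb{R}^n$ and all $p,q\in\mathbb{R}^n$ with $|p|,|q|\le R$; (4) $\lim_{|p|\to\infty}\big(\inf_{x\in\mathbb{R}^n}H(x,p)\big)=+\infty$; (5) $p\mapsto H(x,p)$ is convex for each $x\in\mathbb{R}^n$. For $k\in\mathbb{N}$ let $u_k$ be the unique state-constraint viscosity solution of $u_k(x)+H(x,Du_k(x))=0$ in $B(0,k)$, and let $u$ be the unique state-constraint viscosity solution of $u(x)+H(x,Du(x))=0$ in $\mathbb{R}^n$. Then: (i) $u(x)\le u_k(x)$ for every $k\in\mathbb{N}$ and $x\in\overline{B(0,k)}$; (ii) there is a constant $C>0$, depending only on the growth of $H$, such that for every $k\in\mathbb{N}$ and each $x\in B(0,k)$, $$u_k(x)\le u(x)+\left(Ce^{\frac{|x|}{C}}\right)e^{-\frac{k}{C}}.$$ In particular, for any fixed $R>0$, $$0\le u_k(x)-u(x)\le\left(Ce^{\frac{R}{C}}\right)e^{-\frac{k}{C}}\qquad\text{for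 all }x\in\overline{B(0,R)}\text{ and }k>R.$$
   Context: $\mathbb{N}=\{1,2,\dots\}$; $B(0,r)$ is the open ball of radius $r$ in $\mathbb{R}^n$. BUC denotes bounded uniformly continuous functions. ''Depending only on the growth of $H$'' means depending only on upper and lower bounds of $H(x,p)$ as functions of $p$, uniform in $x$, and not on the regularity of $H$ (such as the moduli $\omega_R$). For an open set $\Omega\subset\mathbb{R}^n$ and a continuous $H$: $v\in \mathrm{BUC}(\Omega;\mathbb{R})$ is a viscosity subsolution of $v+H(x,Dv)=0$ in $\Omega$ if for every $x\in\Omega$ and $\varphi\in C^1(\Omega)$ such that $v-\varphi$ has a local maximum over $\Omega$ at $x$, $v(x)+H(x,D\varphi(x))\le 0$. $v\in \mathrm{BUC}(\overline\Omega;\mathbb{R})$ is a viscosity supersolution on $\overline\Omega$ if for every $x\in\overline\Omega$ and $\varphi\in C^1(\overline\Omega)$ (i.e. $C^1$ on a neighborhood of $\overline\Omega$) such that $v-\varphi$ has a local minimum over $\overline\Omega$ at $x$, $v(x)+H(x,D\varphi(x))\ge 0$. A state-constraint viscosity solution in $\Omega$ is a function that is both a viscosity subsolution in $\Omega$ and a viscosity supersolution on $\overline\Omega$. For $\Omega=\mathbb{R}^n$ this is the usual notion of viscosity solution in $\mathrm{BUC}(\mathbb{R}^n)$. Under the hypotheses of the claim, such solutions exist and are unique. *)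

(* Defs.v *)
From mathcomp Require Import all_boot all_order all_algebra.
From mathcomp Require Import all_classical all_reals all_analysis.

Set Implicit Arguments.
Unset Strict Implicit.
Unset Printing Implicit Defensive.

Import Order.TTheory GRing.Theory Num.Theory.
Import numFieldNormedType.Exports.

Local Open Scope classical_set_scope.
Local Open Scope ring_scope.

(* The library norm `|x| on 'rV[R]_n is the sup norm; it is used only through
   the topology and the uniformity, which the Euclidean norm also induces. *)
Definition enorm (R : realType) (n : nat) (x : 'rV[R]_n) : R :=
  Num.sqrt (\sum_(i < n) x 0 i ^+ 2).

Definition eball (R : realType) (n : nat) (r : R) : set 'rV[R]_n :=
  [set x | enorm x < r].

Definition grad (R : realType) (n : nat) (f : 'rV[R]_n -> R) (x : 'rV[R]_n) :
    'rV[R]_n :=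
  \row_(i < n) 'D_(delta_mx 0 i) f x.

(* Meant for U open. *)
Definition C1_on (R : realType) (n : nat) (U : set 'rV[R]_n)
    (f : 'rV[R]_n -> R) : Prop :=
  forall x, U x -> differentiable f x /\ {for x, continuous (grad f)}.

Definition C1_near (R : realType) (n : nat) (A : set 'rV[R]_n)
    (f : 'rV[R]_n -> R) : Prop :=
  exists U, [/\ open U, A `<=` U & C1_on U f].

(* Functions on A are represented by total functions, whose values outside A
   are irrelevant: unif_continuous is taken for the uniformity of subspace A. *)
Definition BUC (R : realType) (n : nat) (A : set 'rV[R]_n)
    (v : 'rV[R]_n -> R) : Prop :=
  [bounded v x | x in A] /\ unif_continuous (v : subspace A -> R).

Definition local_max_over (R : realType) (n : nat) (A : set 'rV[R]_n)
    (f : 'rV[R]_n -> R) (x : 'rV[R]_n) : Prop :=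
  \forall y \near x, A y -> f y <= f x.

Definition local_min_over (R : realType) (n : nat) (A : set 'rV[R]_n)
    (f : 'rV[R]_n -> R) (x : 'rV[R]_n) : Prop :=
  \forall y \near x, A y -> f x <= f y.

Definition viscosity_subsolution (R : realType) (n : nat)
    (H : 'rV[R]_n -> 'rV[R]_n -> R) (Omega : set 'rV[R]_n)
    (v : 'rV[R]_n -> R) : Prop :=
  BUC Omega v /\
  forall x phi, Omega x -> C1_on Omega phi ->
    local_max_over Omega (fun y => v y - phi y) x ->
    v x + H x (grad phi x) <= 0.

Definition viscosity_supersolution (R : realType) (n : nat)
    (H : 'rV[R]_n -> 'rV[R]_n -> R) (Omega : set 'rV[R]_n)
    (v : 'rV[R]_n -> R) : Prop :=
  BUC (closure Omega) v /\
  forall x phi, closure Omega x -> C1_near (closure Omega) phi ->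
    local_min_over (closure Omega) (fun y => v y - phi y) x ->
    0 <= v x + H x (grad phi x).

Definition state_constraint_solution (R : realType) (n : nat)
    (H : 'rV[R]_n -> 'rV[R]_n -> R) (Omega : set 'rV[R]_n)
    (v : 'rV[R]_n -> R) : Prop :=
  viscosity_subsolution H Omega v /\ viscosity_supersolution H Omega v.

(* g p --> +oo as the Euclidean norm of p tends to +oo *)
Definition coercive (R : realType) (n : nat) (g : 'rV[R]_n -> R) : Prop :=
  forall A : R, exists M : R, forall p, M <= enorm p -> A <= g p.

Definition modulus (R : realType) (w : R -> R) : Prop :=
  [/\ forall s, 0 <= s -> 0 <= w s,
      forall s t, 0 <= s -> s <= t -> w s <= w t
    & w s @[s --> 0^'+] --> (0 : R)].

(* In hyp_coercive, the real infimum is that of a set bounded below, by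
   hyp_bounded_below. *)
Record hamiltonian_hyp (R : realType) (n : nat)
    (H : 'rV[R]_n -> 'rV[R]_n -> R) : Prop := HamiltonianHyp {
  hyp_continuous : continuous (fun z : 'rV[R]_n * 'rV[R]_n => H z.1 z.2) ;
  hyp_bounded_below : exists2 C1 : R, 0 < C1 & forall x p, - C1 <= H x p ;
  hyp_bounded_at0 : exists2 C2 : R, 0 < C2 & forall x, `|H x 0| <= C2 ;
  hyp_modulus : forall r : R, 0 < r -> exists2 w : R -> R, modulus w &
    (forall x y p, enorm p <= r ->
       `|H x p - H y p| <= w (enorm (x - y))) /\
    (forall x p q, enorm p <= r -> enorm q <= r ->
       `|H x p - H x q| <= w (enorm (p - q))) ;
  hyp_coercive : coercive (fun p => inf (range (fun x => H x p))) ;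
  hyp_convex : forall x, convex_function [set: 'rV[R]_n] (H x) }.

(* lo and hi control the growth of H. A constant that is chosen after lo and hi
   but before H depends only on the growth of H. *)
Definition growth_bounds (R : realType) (n : nat) (lo hi : 'rV[R]_n -> R)
    (H : 'rV[R]_n -> 'rV[R]_n -> R) : Prop :=
  forall x p, lo p <= H x p <= hi p.

(* Every admissible H has growth bounds with lo coercive, namely its infimum and
   supremum over x. *)
Lemma growth_bounds_exist (R : realType) (n : nat)
    (H : 'rV[R]_n -> 'rV[R]_n -> R) : hamiltonian_hyp H ->
  exists lo hi, coercive lo /\ growth_bounds lo hi H.
Proof.
case=> _ [C1 _ H1] [C2 _ H2] H3 H4 _.
exists (fun p => inf (range (fun x => H x p))).
exists (fun p => sup (range (fun x => H x p))); split=> // x p.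
have e0 : enorm (0 : 'rV[R]_n) = 0.
  by rewrite /enorm big1 ?sqrtr0// => i _; rewrite mxE expr0n.
have p0 : 0 <= enorm p by exact: sqrtr_ge0.
have [w _ [_ Hw]] := H3 _ (ltr_wpDl p0 ltr01).
apply/andP; split.
  by apply: ge_inf; [exists (- C1) => _ [y _ <-]|exists x].
apply: ub_le_sup; last by exists x.
exists (w (enorm (p - 0)) + C2) => _ [y _ <-].
rewrite -[H y p](subrK (H y 0)) lerD//.
  apply: le_trans (ler_norm _) (Hw _ _ _ _ _); first by rewrite lerDl.
  by rewrite e0 addr_ge0.
exact: le_trans (ler_norm _) (H2 _).
Qed.

(* Main.v *)
(** Both bounds come from one comparison principle proved by doubling the
    variables. If the maximum of [v x - phi x - w y - c |x - y|^2] sits at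
    [(x, y)] with [x] interior, then [p = 2 c (x - y)] is a momentum for both
    equations, coercivity bounds it, and letting [c] grow, the modulus of [H] in
    [x] makes [v - phi > w] impossible. No boundary issue arises as soon as
    [v - phi <= w] holds where the subsolution [v] has no equation.

    For [u <= u_k], take [v = u], which is a subsolution on the whole space, and
    [phi = 0]. For the converse, take [v = u_k], [w = u] and the barrier
    [phi x = c exp ((sqrt (1 + |x|^2) - sqrt (1 + k^2)) / c)]. On the sphere
    [phi >= c], which exceeds the a priori bound on [u_k - u]. Inside,
    [phi <= c] and [D phi] is [phi / c] times a vector of norm at most 1, so by
    convexity subtracting [D phi] from a momentum of norm at most [M] raises
    [H] by at most [phi / c] times the oscillation of [H] on a fixed ball, and
    [u_k - phi] remains a subsolution once [c] is larger than that oscillation.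
    Convexity also makes this oscillation depend only on the growth bounds. *)

Require Import Defs.
From mathcomp Require Import all_boot all_order all_algebra.
From mathcomp Require Import all_classical all_reals all_analysis.
From mathcomp Require Import ring lra.

Set Implicit Arguments.
Unset Strict Implicit.
Unset Printing Implicit Defensive.

Import Order.TTheory GRing.Theory Num.Theory.
Import numFieldNormedType.Exports.

Local Open Scope classical_set_scope.
Local Open Scope ring_scope.

(** * The Euclidean norm and C1 functions *)

Section EuclideanNorm.
Context {R : realType} {n : nat}.
Implicit Types (x y p q : 'rV[R]_n) (a r : R).

Lemma enorm_ge0 x : 0 <= enorm x.
Proof. exact: sqrtr_ge0. Qed.

Lemma sqr_enorm x : enorm x ^+ 2 = \sum_(i < n) x 0 i ^+ 2.
Proof. by rewrite sqr_sqrtr// sumr_ge0// => i _; exact: sqr_ge0. Qed.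

Lemma enorm0 : enorm (0 : 'rV[R]_n) = 0.
Proof. by rewrite /enorm big1 ?sqrtr0// => i _; rewrite mxE expr0n. Qed.

Lemma enormZ a x : enorm (a *: x) = `|a| * enorm x.
Proof.
rewrite /enorm -sqrtr_sqr -sqrtrM ?sqr_ge0// mulr_sumr; congr Num.sqrt.
by apply: eq_bigr => i _; rewrite mxE exprMn.
Qed.

Lemma enormN x : enorm (- x) = enorm x.
Proof. by rewrite -scaleN1r enormZ normrN1 mul1r. Qed.

Lemma coord_le_enorm x i : `|x 0 i| <= enorm x.
Proof.
rewrite -sqrtr_sqr ler_wsqrtr// (bigD1 i)//= lerDl sumr_ge0// => j _.
exact: sqr_ge0.
Qed.

(** The parallelogram law with the square of [x + y] dropped. It stands in for the triangle
    inequality in estimates where a constant factor is harmless. *)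
Lemma enorm_sqrB_le x y :
  enorm (x - y) ^+ 2 <= 2 * enorm x ^+ 2 + 2 * enorm y ^+ 2.
Proof.
rewrite !sqr_enorm !mulr_sumr -big_split/=; apply: ler_sum => i _.
rewrite !mxE; have := sqr_ge0 (x 0 i + y 0 i); nra.
Qed.

Lemma enorm_leP r x : 0 <= r -> (enorm x <= r) = (enorm x ^+ 2 <= r ^+ 2).
Proof. by move=> r0; rewrite ler_pXn2r// nnegrE ?enorm_ge0. Qed.

Lemma mx_norm_le_enorm x : `|x| <= enorm x.
Proof.
rewrite /Num.norm/= mx_normrE; apply/bigmax_leP; split=> [|[i j] _ /=].
  exact: enorm_ge0.
by rewrite ord1; exact: coord_le_enorm.
Qed.

(** Carrying the gradient explicitly lets the calculus rules below build a test function and compute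
    its momentum together. The global form yields both [C1_on] and [C1_near]. *)
Definition C1_grad (f : 'rV[R]_n -> R) (g : 'rV[R]_n -> 'rV[R]_n) :=
  (forall x, differentiable f x /\ grad f x = g x) /\ continuous g.

Lemma gradE (f : 'rV[R]_n -> R) x : differentiable f x ->
  grad f x = \row_i 'd f x (delta_mx 0 i).
Proof. by move=> df; apply/rowP => i; rewrite !mxE deriveE. Qed.

Lemma C1_grad_C1_on (f : 'rV[R]_n -> R) g U : C1_grad f g -> C1_on U f.
Proof.
move=> [fg gc] x _; split; first by have [] := fg x.
have -> : grad f = g by apply/funext => y; have [] := fg y.
exact: gc.
Qed.

Lemma C1_grad_C1_near (f : 'rV[R]_n -> R) g A : C1_grad f g -> C1_near A f.
Proof.
by move=> fg; exists setT; split=> //; [exact: openT|exact: C1_grad_C1_on fg].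
Qed.

Lemma C1_gradE (f : 'rV[R]_n -> R) g x : C1_grad f g -> grad f x = g x.
Proof. by move=> [fg _]; have [] := fg x. Qed.

Lemma C1_grad_continuous (f : 'rV[R]_n -> R) g : C1_grad f g -> continuous f.
Proof.
by move=> [fg _] x; apply: differentiable_continuous; have [] := fg x.
Qed.

Lemma C1_grad_cst a : C1_grad (cst a) (cst 0).
Proof.
split=> [x|]; last exact: cst_continuous.
have dc : differentiable (cst a : 'rV[R]_n -> R) x by exact: differentiable_cst.
by split=> //; rewrite gradE// diff_cst; apply/rowP => i; rewrite !mxE.
Qed.

Lemma C1_gradD (f1 f2 : 'rV[R]_n -> R) g1 g2 : C1_grad f1 g1 -> C1_grad f2 g2 ->
  C1_grad (fun x => f1 x + f2 x) (fun x => g1 x + g2 x).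
Proof.
move=> [fg1 c1] [fg2 c2]; split=> [x|x]; last exact: (cvgD (c1 x) (c2 x)).
have [d1 <-] := fg1 x; have [d2 <-] := fg2 x.
have d12 : differentiable (f1 + f2) x by exact: differentiableD.
split=> //; rewrite (gradE d12) (gradE d1) (gradE d2) diffD//.
by apply/rowP => i; rewrite !mxE.
Qed.

(** The derivative of [h] is asked only at values of [f], which allows [Num.sqrt] along a positive
    [f]. *)
Lemma C1_grad_comp (h h' : R -> R) (f : 'rV[R]_n -> R) g :
  (forall x, is_derive (f x) 1 h (h' (f x))) ->
  (forall x, {for f x, continuous h'}) -> C1_grad f g ->
  C1_grad (fun x => h (f x)) (fun x => h' (f x) *: g x).
Proof.
move=> hd hc fg; have fc := C1_grad_continuous fg.
case: fg => fg gc; split=> [x|x]; last first.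
  have hf := @continuous_comp _ _ _ f h' x (fc x) (hc x).
  exact: (cvgZ hf (gc x)).
have [df <-] := fg x.
have dh : differentiable h (f x).
  by apply/derivable1_diffP; exact: (@ex_derive _ _ _ _ _ _ _ (hd x)).
have dhf : differentiable (h \o f) x by exact: differentiable_comp.
split=> //; rewrite (gradE dhf) (gradE df) diff_comp//.
apply/rowP => i; rewrite !mxE/= deriv1E; last exact/derivable1_diffP.
by rewrite derive1E (@derive_val _ _ _ _ _ _ _ (hd x)) mulrC.
Qed.

Lemma C1_gradZ a (f : 'rV[R]_n -> R) g : C1_grad f g ->
  C1_grad (fun x => a * f x) (fun x => a *: g x).
Proof.
move=> fg; apply: (@C1_grad_comp ( *%R a) (cst a)) fg => x; last exact: cvg_cst.
by apply: is_derive_eq; rewrite /GRing.scale/= mulr1.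
Qed.

Lemma C1_grad_sqr_coord y i : C1_grad (fun x => (x 0 i - y 0 i) ^+ 2)
  (fun x => 2 * (x 0 i - y 0 i) *: delta_mx 0 i).
Proof.
apply: (@C1_grad_comp (fun t => (t - y 0 i) ^+ 2) (fun t => 2 * (t - y 0 i))
  (fun x => x 0 i) (cst (delta_mx 0 i))).
- move=> x; apply: is_derive_eq; rewrite /GRing.scale/=; ring.
- move=> x; apply: cvgM; first exact: cvg_cst.
  by apply: cvgB; [exact: cvg_id|exact: cvg_cst].
split=> [x|]; last exact: cst_continuous.
have dx := differentiable_coord x 0 i; split=> //; apply/rowP => j.
rewrite !mxE /derive; apply/cvg_lim => //=.
have -> : (fun h : R => h^-1 *: ((h *: delta_mx 0 j + x) 0 i - x 0 i)) =
    fun h => h^-1 * (h * (i == j)%:R).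
  by apply/funext => h; rewrite !mxE/= addrK.
rewrite eq_sym; apply: cvg_near_cst; near=> h.
rewrite mulrA mulVf ?mul1r//.
by near: h; exact: nbhs_dnbhs_neq.
Unshelve. all: by end_near. Qed.

Lemma C1_grad_sum (f : 'I_n -> 'rV[R]_n -> R) g (s : seq 'I_n) :
  (forall i, C1_grad (f i) (g i)) ->
  C1_grad (fun x => \sum_(i <- s) f i x) (fun x => \sum_(i <- s) g i x).
Proof.
move=> fg; elim: s => [|i s IH].
  have -> : (fun x => \sum_(i <- [::]) f i x) = cst 0.
    by apply/funext => x; rewrite big_nil.
  have -> : (fun x => \sum_(i <- [::]) g i x) = cst 0.
    by apply/funext => x; rewrite big_nil.
  exact: C1_grad_cst.
under [fun x => _]eq_fun do rewrite big_cons.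
under [X in C1_grad _ X]eq_fun do rewrite big_cons.
exact: C1_gradD.
Qed.

Lemma C1_grad_sqr_enorm y :
  C1_grad (fun x => enorm (x - y) ^+ 2) (fun x => 2 *: (x - y)).
Proof.
under [fun x => _]eq_fun do rewrite sqr_enorm.
have -> : (fun x => 2 *: (x - y)) =
    (fun x => \sum_(i < n) (2 * (x 0 i - y 0 i)) *: delta_mx 0 i).
  apply/funext => x; rewrite [LHS]row_sum_delta; apply: eq_bigr => i _.
  by rewrite !mxE.
under eq_fun do under eq_bigr do rewrite !mxE.
by apply: C1_grad_sum => i; exact: C1_grad_sqr_coord.
Qed.

Lemma continuous_enorm : continuous (@enorm R n).
Proof.
move=> x.
apply: (@continuous_comp _ _ _ _ Num.sqrt); last exact: sqrt_continuous.
have := C1_grad_continuous (C1_grad_sqr_enorm 0).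
by under [fun x => _]eq_fun do rewrite subr0 sqr_enorm; exact.
Qed.

Lemma open_eball r : open (@eball R n r).
Proof.
have -> : eball r = @enorm R n @^-1` [set t | t < r] by [].
by apply: open_comp => [x _|]; [exact: continuous_enorm|exact: open_lt].
Qed.

Lemma closed_enorm_le r : closed [set x : 'rV[R]_n | enorm x <= r].
Proof.
apply: (@closed_comp _ _ (@enorm R n) [set t | t <= r]) => [x _|].
  exact: continuous_enorm.
exact: closed_le.
Qed.

Lemma compact_enorm_le r : compact [set x : 'rV[R]_n | enorm x <= r].
Proof.
apply: bounded_closed_compact; last exact: closed_enorm_le.
exists r; split; first exact: num_real.
move=> M rM x /= xr; apply: (le_trans (mx_norm_le_enorm x)).
exact: le_trans xr (ltW rM).
Qed.

Lemma closure_eball_le r x : closure (eball r) x -> enorm x <= r.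
Proof.
suff : closure (eball r) `<=` [set x : 'rV[R]_n | enorm x <= r] by exact.
have /closure_id -> : closed [set x : 'rV[R]_n | enorm x <= r].
  exact: closed_enorm_le.
by apply: closure_subset => y /ltW.
Qed.

End EuclideanNorm.

(** * Convex functions with prescribed growth *)

Section ConvexGrowth.
Context {R : realType} {n : nat}.
Implicit Types (f lo hi : 'rV[R]_n -> R) (p a b : 'rV[R]_n) (r t : R).

Lemma convex_functionP f : convex_function [set: 'rV[R]_n] f ->
  forall t a b, 0 <= t -> t <= 1 ->
  f (t *: a + (1 - t) *: b) <= t * f a + (1 - t) * f b.
Proof.
by move=> fc t a b t0 t1; apply: (fc (Itv01 t0 t1)); rewrite inE.
Qed.

(* Induction on the number of coordinates of [p] that may be nonzero:
   [p + q] is the midpoint of [2 p] and [2 q], so one coordinate is split off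
   at the price of doubling [r]. *)
Lemma convex_le_coord hi (m : nat) r : 0 < r -> exists K : R, forall f,
  convex_function [set: 'rV[R]_n] f -> (forall p, f p <= hi p) ->
  forall p, (forall i, `|p 0 i| <= r) ->
    (forall i : 'I_n, (m <= i)%N -> p 0 i = 0) -> f p <= K.
Proof.
elim: m r => [|m IH] r r0.
  exists (hi 0) => f _ fhi p _ p0.
  by have -> : p = 0 by apply/rowP => i; rewrite mxE p0.
have r20 : 0 < 2 * r by rewrite mulr_gt0.
have [K KP] := IH _ r20.
have [mn|nm] := ltnP m n; last first.
  exists K => f fc fhi p pr pm; apply: (KP f) => // i.
    by apply: (le_trans (pr i)); lra.
  by move=> mi; have := leq_trans nm mi; rewrite leqNgt ltn_ord.
pose e : 'rV[R]_n := delta_mx 0 (Ordinal mn).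
(* The segment from [- 2 r e] to [2 r e] contains every [2 c e] with [|c| <= r]. The weights of its
   endpoints vary with [p], and absolute values bound both contributions. *)
exists (1 / 2 * (`|hi ((2 * r) *: e)| + `|hi (- (2 * r) *: e)|) +
  (1 - 1 / 2) * K).
move=> f fc fhi p pr pm.
pose c := p 0 (Ordinal mn).
have -> : p = (1 / 2) *: ((2 * c) *: e) + (1 - 1 / 2) *: (2 *: (p - c *: e)).
  by apply/rowP => i; rewrite !mxE; field.
apply: le_trans (convex_functionP fc _ _ _ _) _; [lra|lra|].
apply: lerD; apply: ler_wpM2l; [lra| |lra|].
  have : `|c| <= r by exact: pr.
  rewrite ler_norml => /andP[rc cr].
  have -> : (2 * c) *: e = ((c + r) / (2 * r)) *: ((2 * r) *: e) +
      (1 - (c + r) / (2 * r)) *: (- (2 * r) *: e).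
    by rewrite !scalerA -scalerDl; congr (_ *: _); field; exact: lt0r_neq0.
  have t0 : 0 <= (c + r) / (2 * r) by apply: divr_ge0; lra.
  have t1 : (c + r) / (2 * r) <= 1 by rewrite ler_pdivrMr//; lra.
  apply: le_trans (convex_functionP fc _ _ t0 t1) _.
  apply: lerD.
    apply: (@le_trans _ _ ((c + r) / (2 * r) * `|hi ((2 * r) *: e)|)).
      by apply: ler_wpM2l => //; apply: (le_trans (fhi _)); exact: ler_norm.
    by apply: ler_piMl.
  apply: (@le_trans _ _ ((1 - (c + r) / (2 * r)) * `|hi (- (2 * r) *: e)|)).
    apply: ler_wpM2l; first lra.
    by apply: (le_trans (fhi _)); exact: ler_norm.
  by apply: ler_piMl => //; lra.
apply: (KP f) => // i.
  rewrite !mxE eqxx/=; case: eqP => [->|_].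
    by rewrite mulr1 subrr mulr0 normr0 ltW.
  by rewrite mulr0 subr0 normrM ger0_norm// ler_pM2l.
move=> mi; rewrite !mxE eqxx/=; case: eqP => [->|im].
  by rewrite mulr1 subrr mulr0.
rewrite mulr0 subr0 pm ?mulr0// ltn_neqAle mi andbT.
by apply/eqP => mi'; apply: im; apply/val_inj.
Qed.

(** Convexity reduces the bound to finitely many values of the arbitrary function [hi], which makes
    [K] common to all [f]. *)
Lemma convex_le_ball hi r : 0 < r -> exists K : R, forall f,
  convex_function [set: 'rV[R]_n] f -> (forall p, f p <= hi p) ->
  forall p, enorm p <= r -> f p <= K.
Proof.
move=> r0; have [K KP] := convex_le_coord hi n r0.
exists K => f fc fhi p pr; apply: (KP f) => // i.
  exact: le_trans (coord_le_enorm p i) pr.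
by rewrite leqNgt ltn_ord.
Qed.

(** Outside a ball coercivity gives [f p >= 0]. Inside, [0] is the midpoint of [p] and [- p], so the
    lower bound on [f 0] and the upper bound on [f (- p)] bound [f p] from below. *)
Lemma convex_ge lo hi : coercive lo -> exists K : R, forall f,
  convex_function [set: 'rV[R]_n] f -> (forall p, lo p <= f p <= hi p) ->
  forall p, K <= f p.
Proof.
move=> /(_ 0)[M MP]; pose r := `|M| + 1.
have r0 : 0 < r by rewrite /r ltr_wpDl.
have [K KP] := convex_le_ball hi r0.
exists (Num.min 0 (2 * lo 0 - K)) => f fc lofhi p.
have [pM|/ltW Mp] := leP (enorm p) r; last first.
  rewrite ge_min; apply/orP; left.
  have /andP[+ _] := lofhi p; apply: le_trans; apply: MP.
  by apply: le_trans Mp; rewrite /r; have := ler_norm M; lra.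
rewrite ge_min; apply/orP; right.
have Np : f (- p) <= K.
  by apply: (KP f); rewrite ?enormN// => q; have /andP[] := lofhi q.
have /andP[lo0 _] := lofhi 0.
have := @convex_functionP f fc (1 / 2) p (- p).
have -> : (1 / 2) *: p + (1 - 1 / 2) *: - p = 0.
  by apply/rowP => i; rewrite !mxE; field.
by move=> /(_ ltac:(lra) ltac:(lra)); lra.
Qed.

End ConvexGrowth.

(** * Penalization and the comparison principle *)

Section Penalization.
Context {R : realType} {n : nat}.
Implicit Types (H : 'rV[R]_n -> 'rV[R]_n -> R) (A B : set 'rV[R]_n).
Implicit Types (f g v w : 'rV[R]_n -> R) (x y p : 'rV[R]_n).

Lemma BUC_bounded A v : BUC A v -> exists M : R, forall x, A x -> `|v x| <= M.
Proof.
move=> [[M [_ MP]] _]; exists (M + 1) => x Ax.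
by apply: MP => //; rewrite ltrDl.
Qed.

Lemma BUC_continuous A v : BUC A v -> {within A, continuous v}.
Proof.
move=> [_ vu] x; apply/cvg_entourageP => /= E entE.
have := nbhs_entourage x (vu _ entE).
by apply: filterS => y /xsectionP.
Qed.

Lemma within_closure_le A v (c : R) : {within closure A, continuous v} ->
  (forall x, A x -> v x <= c) -> forall x, closure A x -> v x <= c.
Proof.
move=> /subspace_continuousP vc vA x Ax; rewrite leNgt; apply/negP => cv.
have /cvgrPdist_lt/(_ (v x - c)) := vc x Ax; rewrite subr_gt0 => /(_ cv) xv.
have [y [Ay]] := Ax _ xv => /(_ (subset_closure Ay)).
by have := vA _ Ay; rewrite /from_subspace ltr_norml => vy /andP[_ vxy]; lra.
Qed.

Lemma local_max_overW A f x :
  (forall y, A y -> f y <= f x) -> local_max_over A f x.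
Proof. by move=> fx; exact: (@filterE _ (nbhs x) _ _ fx). Qed.

Lemma local_min_overW A f x :
  (forall y, A y -> f x <= f y) -> local_min_over A f x.
Proof. by move=> fx; exact: (@filterE _ (nbhs x) _ _ fx). Qed.

(** The penalty keeps [x] and [y] close in every competitive pair, so boundedness of one set
    confines both, and the maximum is taken over a compact set. *)
Lemma penalized_max A B f g (M c r : R) x0 : closed A -> closed B ->
  {within A, continuous f} -> {within B, continuous g} -> 0 < c ->
  A x0 -> B x0 -> (forall x y, A x -> B y -> f x - g y <= M) ->
  (forall x, A x -> enorm x <= r) \/ (forall y, B y -> enorm y <= r) ->
  exists x y, [/\ A x, B y & forall x' y', A x' -> B y' ->
    f x' - g y' - c * enorm (x' - y') ^+ 2 <=
    f x - g y - c * enorm (x - y) ^+ 2].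
Proof.
move=> clA clB fA gB c0 Ax0 Bx0 fgM AB.
pose F z := f z.1 - g z.2 - c * enorm (z.1 - z.2) ^+ 2.
(* Beyond this squared distance the penalty brings the value below that at [(x0, x0)]. *)
pose D := (M - (f x0 - g x0)) / c.
have D0 : 0 <= D by apply: divr_ge0; [rewrite subr_ge0 fgM|exact: ltW].
pose K := [set z | [/\ A z.1, B z.2 & enorm (z.1 - z.2) ^+ 2 <= D]].
have Kx0 : K (x0, x0) by split=> //=; rewrite subrr enorm0 expr0n.
have cc : continuous (fun z : 'rV[R]_n * 'rV[R]_n => enorm (z.1 - z.2) ^+ 2).
  move=> z; have h : continuous (fun x : 'rV[R]_n => enorm x ^+ 2).
    have := C1_grad_continuous (C1_grad_sqr_enorm (0 : 'rV[R]_n)).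
    by under [fun x => _]eq_fun do rewrite subr0.
  apply: (@continuous_comp _ _ _
    (fun z : 'rV[R]_n * 'rV[R]_n => z.1 - z.2) _ z _ (h _)).
  exact: (cvgB (@cvg_fst _ _ _ _ _) (@cvg_snd _ _ _ _ _)).
have clK : closed K.
  have -> : K = fst @^-1` A `&` snd @^-1` B `&`
      (fun z : 'rV[R]_n * 'rV[R]_n => enorm (z.1 - z.2) ^+ 2) @^-1`
      [set t | t <= D].
    by apply/seteqP; split=> z; [move=> []|move=> [[]]].
  apply: closedI; last first.
    by apply: closed_comp => [z _|]; [exact: cc|exact: closed_le].
  apply: closedI; apply: closed_comp => // z _; [exact: cvg_fst|exact: cvg_snd].
(* Large enough that [2 r^2 + 2 D <= r1^2], the bound produced by [enorm_sqrB_le]. *)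
pose r1 := 2 * `|r| + D + 1.
have r10 : 0 <= r1 by rewrite /r1; have := normr_ge0 r; lra.
have rr1 : r <= r1 by rewrite /r1; have := ler_norm r; have := normr_ge0 r; lra.
have near_ball x y : enorm x <= r -> enorm (x - y) ^+ 2 <= D -> enorm y <= r1.
  move=> xr xyD; rewrite enorm_leP//.
  have -> : y = x - (x - y) by rewrite opprB addrC subrK.
  apply: (le_trans (enorm_sqrB_le _ _)).
  have : enorm x ^+ 2 <= `|r| ^+ 2.
    by rewrite -enorm_leP//; exact: le_trans xr (ler_norm r).
  by move: xyD; rewrite /r1; have := normr_ge0 r; nra.
have cptK : compact K.
  pose E := [set x : 'rV[R]_n | enorm x <= r1].
  apply: (@subclosed_compact _ K (E `*` E) clK).
    by apply: compact_setX; exact: compact_enorm_le.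
  move=> [x y] [/= Ax By xyD]; case: AB => [/(_ _ Ax)|/(_ _ By)] xr.
    by split=> /=; [exact: le_trans rr1|exact: near_ball xyD].
  split=> /=; last exact: le_trans rr1.
  by apply: near_ball xr _; rewrite -enormN opprB.
have FK : {within K, continuous F}.
  apply: (@continuous_subspaceW _ _ K (A `*` B)) => [z []//|].
  apply/subspace_continuousP => -[x y] [/= Ax By].
  have cf : f z.1 @[z --> within (A `*` B) (nbhs (x, y))] --> f x.
    apply: cvg_comp ((@subspace_continuousP _ _ _ _).1 fA _ Ax) => U /= UA.
    have : \forall z \near (x, y), A z.1 -> U z.1.
      by move: UA; exact: (@cvg_fst _ _ (nbhs x) (nbhs y) _).
    by apply: filterS => z zU [/zU].
  have cg : g z.2 @[z --> within (A `*` B) (nbhs (x, y))] --> g y.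
    apply: cvg_comp ((@subspace_continuousP _ _ _ _).1 gB _ By) => U /= UA.
    have : \forall z \near (x, y), B z.2 -> U z.2.
      by move: UA; exact: (@cvg_snd _ _ (nbhs x) (nbhs y) _).
    by apply: filterS => z zU [_ /zU].
  apply: cvgB; first exact: cvgB.
  apply: cvgM; first exact: cvg_cst.
  by apply: cvg_within_filter; exact: cc.
have [[x y] /set_mem [/= Ax By xyD] xymax] :=
  compact_EVT_max (ex_intro _ _ Kx0) cptK FK.
exists x, y; split=> // x' y' Ax' By'.
have [D'|D'] := leP (enorm (x' - y') ^+ 2) D.
  by apply: (xymax (x', y')); apply/mem_set.
have /= := xymax (x0, x0) (mem_set Kx0); rewrite /F/= subrr enorm0 expr0n mulr0.
apply: le_trans.
have := fgM _ _ Ax' By'; move: D'; rewrite /D ltr_pdivrMr// [_ * c]mulrC; lra.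
Qed.

(** For [x0] in [Omega], a maximum point [x] of [v - c |x - x0|^2] admits a smooth test function
    from above, so [v x0 <= v x <= - H <= C]. Continuity carries the bound to the closure. *)
Lemma subsolution_le H (Omega : set 'rV[R]_n) v (C : R) :
  open Omega -> BUC (closure Omega) v -> viscosity_subsolution H Omega v ->
  (forall x p, - C <= H x p) -> forall x, closure Omega x -> v x <= C.
Proof.
move=> oO vO [_ sub] HC.
apply: within_closure_le (BUC_continuous vO) _ => x0 Ox0.
have [M MP] := BUC_bounded vO.
have /nbhs_ballP[/= d d0 dO] : nbhs x0 Omega by exact: open_nbhs_nbhs.
have M0 : 0 <= M := le_trans (normr_ge0 _) (MP _ (subset_closure Ox0)).
(* [c d^2] exceeds the oscillation [2 M] of [v], so the maximum point lies within [d] of [x0], hence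
   in [Omega]. *)
pose c := (2 * M + 1) / d ^+ 2.
have c0 : 0 < c by rewrite divr_gt0 ?exprn_gt0//; lra.
have [|||||||||x [_ [Ox -> xmax]]] := @penalized_max (closure Omega) [set x0]
  v (cst 0) M c (enorm x0) x0.
- exact: closed_closure.
- exact: accessible_closed_set1 (hausdorff_accessible (@norm_hausdorff _ _)) _.
- exact: BUC_continuous.
- by apply: continuous_subspaceT; exact: cst_continuous.
- by [].
- exact: subset_closure.
- by [].
- by move=> y z Oy _; rewrite subr0; exact: le_trans (ler_norm _) (MP _ Oy).
- by right=> y ->.
have {}Ox' : Omega x.
  apply: dO; rewrite -ball_normE /=; apply: (le_lt_trans (mx_norm_le_enorm _)).
  rewrite -enormN opprB ltNge; apply/negP => dx.
  have := xmax _ _ (subset_closure Ox0) erefl.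
  rewrite subrr enorm0 expr0n mulr0 !subr0.
  have : c * d ^+ 2 <= c * enorm (x - x0) ^+ 2.
    by rewrite ler_pM2l// ler_pXn2r// ?nnegrE ?enorm_ge0 ?ltW.
  rewrite {1}/c divfK ?lt0r_neq0 ?exprn_gt0//.
  have := MP _ Ox; have := MP _ (subset_closure Ox0).
  by rewrite !ler_norml => /andP[? ?] /andP[? ?]; lra.
have C1psi := C1_gradZ c (C1_grad_sqr_enorm x0).
have test : local_max_over Omega (fun y => v y - c * enorm (y - x0) ^+ 2) x.
  apply: local_max_overW => y Oy.
  by have := xmax y x0 (subset_closure Oy) erefl; rewrite !subr0.
have := sub _ _ Ox' (C1_grad_C1_on C1psi) test.
have := HC x (grad (fun y => c * enorm (y - x0) ^+ 2) x).
have := xmax _ _ (subset_closure Ox0) erefl.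
rewrite subrr enorm0 expr0n mulr0 !subr0.
have := mulr_ge0 (ltW c0) (sqr_ge0 (enorm (x - x0))); lra.
Qed.

(** The infimum of [w] need not be attained, so a weak quadratic penalty is added. Its gradient at
    the minimum point has norm at most 1, and there [w >= - H >= - K]. *)
Lemma supersolution_ge H w (K : R) :
  viscosity_supersolution H [set: 'rV[R]_n] w ->
  (forall x p, enorm p <= 1 -> H x p <= K) -> forall x, - K <= w x.
Proof.
rewrite /viscosity_supersolution closureT => -[wT sup] HK x0.
have [M MP] := BUC_bounded wT.
have M0 : 0 <= M := le_trans (normr_ge0 _) (MP x0 I).
(* Minimality gives [c |x - x0|^2 <= 2 M], so the squared norm [4 c (c |x - x0|^2)] of the momentum
   is at most [8 c M <= 1]. *)
pose c := (8 * M + 1)^-1.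
have c0 : 0 < c by rewrite invr_gt0; lra.
have [|||||||||_ [x [-> _ xmax]]] := @penalized_max [set x0] setT
  (cst 0) w M c (enorm x0) x0.
- exact: accessible_closed_set1 (hausdorff_accessible (@norm_hausdorff _ _)) _.
- exact: closedT.
- by apply: continuous_subspaceT; exact: cst_continuous.
- exact: BUC_continuous.
- by [].
- by [].
- by [].
- move=> y z _ _; rewrite sub0r; apply: le_trans (ler_norm _) _.
  by rewrite normrN; exact: MP.
- by left=> y ->.
have C1psi := C1_gradZ (- c) (C1_grad_sqr_enorm x0).
have xmax' y : w x + c * enorm (x - x0) ^+ 2 <= w y + c * enorm (y - x0) ^+ 2.
  have := xmax x0 y erefl I; rewrite /= !sub0r.
  by rewrite -[enorm (x0 - y)]enormN -[enorm (x0 - x)]enormN !opprB; lra.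
have test : local_min_over setT (fun y => w y - - c * enorm (y - x0) ^+ 2) x.
  by apply: local_min_overW => y _; have := xmax' y; lra.
have := sup _ _ I (C1_grad_C1_near _ C1psi) test; rewrite (C1_gradE x C1psi).
have := xmax' x0; rewrite subrr enorm0 expr0n mulr0 addr0 => wx.
have cx : c * enorm (x - x0) ^+ 2 <= 2 * M.
  have := MP x I; have := MP x0 I.
  by rewrite !ler_norml => /andP[? ?] /andP[? ?]; lra.
suff : H x (- c *: (2 *: (x - x0))) <= K.
  by have := mulr_ge0 (ltW c0) (sqr_ge0 (enorm (x - x0))); lra.
apply: HK; rewrite !enormZ normrN (gtr0_norm c0) ger0_norm//.
rewrite -(@ler_pXn2r _ 2)// ?nnegrE ?mulr_ge0 ?enorm_ge0 ?(ltW c0)//.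
have -> : (c * (2 * enorm (x - x0))) ^+ 2 = 4 * c * (c * enorm (x - x0) ^+ 2).
  by ring.
rewrite expr1n; apply: (@le_trans _ _ (4 * c * (2 * M))).
  by apply: ler_wpM2l => //; lra.
have : c * (8 * M + 1) = 1 by rewrite mulVf// lt0r_neq0//; lra.
by lra.
Qed.

End Penalization.

Section Comparison.
Context {R : realType} {n : nat}.
Implicit Types (H : 'rV[R]_n -> 'rV[R]_n -> R) (x y p : 'rV[R]_n).

Lemma modulus_small (om : R -> R) (d : R) : modulus om -> 0 < d ->
  exists2 s, 0 < s & forall t, 0 <= t -> t <= s -> om t < d.
Proof.
move=> [om0 om_nd om_cvg] d0.
have /cvgrPdist_lt/(_ d d0) := om_cvg.
rewrite /at_right near_withinE => /nbhs_ballP[/= e e0 ed].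
have e20 : 0 < e / 2 by rewrite divr_gt0.
exists (e / 2) => // t t0 te; apply: le_lt_trans (om_nd _ _ t0 te) _.
have : `|0 - om (e / 2)| < d.
  by apply: ed => //; rewrite /ball/= sub0r normrN gtr0_norm//; lra.
by rewrite sub0r normrN ger0_norm// om0// ltW.
Qed.

(* The comparison is between [v - phi] and [w]; the last hypothesis on [phi]
   says that [v - phi] is formally still a subsolution where it exceeds [w],
   and bounds the momenta that occur there. *)
Lemma comparison H (Omega Omega' : set 'rV[R]_n) (v w phi : 'rV[R]_n -> R) g
    (r r' : R) :
  hamiltonian_hyp H ->
  viscosity_subsolution H Omega v -> BUC (closure Omega) v ->
  viscosity_supersolution H Omega' w ->
  C1_grad phi g -> (forall x, 0 <= phi x) ->
  (forall x, closure Omega x -> enorm x <= r) \/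
    (forall y, closure Omega' y -> enorm y <= r) ->
  (forall x y, closure Omega x -> ~ Omega x -> closure Omega' y ->
    v x - phi x <= w y) ->
  (forall x y p, Omega x -> closure Omega' y -> w y <= v x - phi x ->
    v x + H x (p + g x) <= 0 -> enorm p <= r' /\ v x - phi x + H x p <= 0) ->
  forall x, closure Omega x -> closure Omega' x -> v x - phi x <= w x.
Proof.
move=> HH [_ sub] vc [wc sup] phig phi0 bdd bdry strict x0 Ox0 O'x0.
rewrite leNgt; apply/negP => wv.
pose d := v x0 - phi x0 - w x0.
have d0 : 0 < d by rewrite subr_gt0.
have r0 : 0 < `|r'| + 1 by rewrite ltr_wpDl.
have [om om_mod [omx _]] := hyp_modulus HH r0.
(* A single penalty suffices: [s] makes the modulus smaller than the gap [d], and the choice of [c]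
   below forces [|x - y| <= s] at the maximum. *)
have [s s0 sd] := modulus_small om_mod d0.
have [Mv MvP] := BUC_bounded vc; have [Mw MwP] := BUC_bounded wc.
have MP x y : closure Omega x -> closure Omega' y ->
    v x - phi x - w y <= Mv + Mw.
  move=> /MvP + /MwP; rewrite !ler_norml => /andP[_ ?] /andP[? _].
  by have := phi0 x; lra.
have M0 : 0 <= Mv + Mw by apply: le_trans (MP _ _ Ox0 O'x0); exact: ltW.
pose c := (Mv + Mw + 1) / s ^+ 2.
have c0 : 0 < c by rewrite divr_gt0 ?exprn_gt0//; lra.
have vphic : {within closure Omega, continuous (fun x => v x - phi x)}.
  have vcont := BUC_continuous vc.
  have phicont : {within closure Omega, continuous phi}.
    by apply: continuous_subspaceT; exact: C1_grad_continuous phig.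
  by move=> x; apply: cvgB; [exact: vcont|exact: phicont].
have [x [y [Ox O'y xymax]]] := penalized_max (@closed_closure _ _)
  (@closed_closure _ _) vphic (BUC_continuous wc) c0 Ox0 O'x0 MP bdd.
have dxy : d <= v x - phi x - w y - c * enorm (x - y) ^+ 2.
  apply: le_trans (xymax _ _ Ox0 O'x0).
  by rewrite subrr enorm0 expr0n mulr0 subr0.
have xy0 := mulr_ge0 (ltW c0) (sqr_ge0 (enorm (x - y))).
have xys : enorm (x - y) <= s.
  rewrite leNgt; apply/negP => sxy.
  have : c * s ^+ 2 <= c * enorm (x - y) ^+ 2.
    by rewrite ler_pM2l// ler_pXn2r// ?nnegrE ?enorm_ge0 ?ltW.
  rewrite {1}/c divfK ?lt0r_neq0 ?exprn_gt0//.
  by have := MP _ _ Ox O'y; lra.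
have {}Ox : Omega x.
  by apply: contrapT => nOx; have := bdry _ _ Ox nOx O'y; lra.
pose p := c *: (2 *: (x - y)).
have C1v := C1_gradD phig (C1_gradZ c (C1_grad_sqr_enorm y)).
have subx : v x + H x (p + g x) <= 0.
  have := sub x _ Ox (C1_grad_C1_on C1v).
  rewrite (C1_gradE x C1v) [g x + _]addrC.
  apply; apply: local_max_overW => z Oz.
  by have := xymax z y (subset_closure Oz) O'y; lra.
(* As a function of [y] the penalty enters with the opposite sign, so its gradient gives the same
   momentum [p] as in the subsolution inequality. *)
have C1w := C1_gradZ (- c) (C1_grad_sqr_enorm x).
have supy : 0 <= w y + H y p.
  have := sup y _ O'y (C1_grad_C1_near _ C1w); rewrite (C1_gradE y C1w).
  have -> : - c *: (2 *: (y - x)) = p by rewrite /p scaleNr -!scalerN opprB.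
  apply; apply: local_min_overW => z Oz.
  have := xymax x z (subset_closure Ox) Oz.
  by rewrite -[enorm (x - z)]enormN -[enorm (x - y)]enormN !opprB; lra.
have wyv : w y <= v x - phi x by lra.
have [pr' subx'] := strict _ _ _ Ox O'y wyv subx.
(* The two inequalities give [d <= H y p - H x p], which is at most the modulus at [|x - y|], hence
   less than [d]. *)
have := sd _ (enorm_ge0 (x - y)) xys.
have := omx x y p; rewrite ler_norml.
have -> : enorm p <= `|r'| + 1.
  by apply: (le_trans pr'); apply: (le_trans (ler_norm _)); rewrite lerDl.
by move=> /(_ isT)/andP[? _]; lra.
Qed.

End Comparison.

(** * The exponential barrier *)

Section Barrier.
Context {R : realType} {n : nat}.
Implicit Types (x y p : 'rV[R]_n) (c s : R).

(** A smooth substitute for [|x|]: it lies between [|x|] and [1 + |x|], and its gradient has norm at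
    most 1. *)
Definition japanese_bracket x : R := Num.sqrt (1 + enorm x ^+ 2).

(** The parameter [s] is the level of the bracket at which the barrier equals [c]. *)
Definition barrier c s x : R := c * expR ((japanese_bracket x - s) / c).

Lemma enorm_le_bracket x : enorm x <= japanese_bracket x.
Proof.
rewrite /japanese_bracket -{1}(ger0_norm (enorm_ge0 x)) -sqrtr_sqr.
by rewrite ler_wsqrtr// lerDr.
Qed.

Lemma bracket_le x : japanese_bracket x <= 1 + enorm x.
Proof.
have e0 := enorm_ge0 x.
rewrite -[leRHS]ger0_norm ?addr_ge0// -sqrtr_sqr ler_wsqrtr//; nra.
Qed.

Lemma bracket_gt0 x : 0 < japanese_bracket x.
Proof. by rewrite sqrtr_gt0 ltr_wpDr ?sqr_ge0. Qed.

Lemma C1_grad_barrier c s : c != 0 -> C1_grad (barrier c s)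
  (fun x => expR ((japanese_bracket x - s) / c) *:
    ((japanese_bracket x)^-1 *: x)).
Proof.
move=> c0.
have C1a := C1_gradD (@C1_grad_cst R n 1) (C1_grad_sqr_enorm 0).
(* Positivity keeps the square root away from its singularity at 0. *)
have pos x : 0 < cst 1 x + enorm (x - 0) ^+ 2 by rewrite /= ltr_wpDr ?sqr_ge0.
have C1b :=
  @C1_grad_comp R n Num.sqrt (fun t => (2 * Num.sqrt t)^-1) _ _ _ _ C1a.
have {}C1b := C1b (fun x => is_derive1_sqrt (pos x)).
have {}C1b : C1_grad japanese_bracket (fun x => (japanese_bracket x)^-1 *: x).
  have -> : japanese_bracket = fun x => Num.sqrt (cst 1 x + enorm (x - 0) ^+ 2).
    by apply/funext => x; rewrite subr0.
  have -> : (fun x => (Num.sqrt (cst 1 x + enorm (x - 0) ^+ 2))^-1 *: x) =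
     fun x => (2 * Num.sqrt (cst 1 x + enorm (x - 0) ^+ 2))^-1 *:
                (cst 0 x + 2 *: (x - 0)).
    apply/funext => x; rewrite add0r scalerA subr0 invfM mulrC.
    by rewrite mulrA divff ?mul1r.
  apply: C1b => x; apply: cvgV.
    by rewrite mulf_neq0// gt_eqF// sqrtr_gt0.
  by apply: cvgM; [exact: cvg_cst|exact: sqrt_continuous].
have C1c := C1_gradZ c^-1 (C1_gradD C1b (@C1_grad_cst R n (- s))).
have C1d := C1_gradZ c (@C1_grad_comp R n expR expR _ _
  (fun x => is_derive_expR _) (fun x => @continuous_expR R _) C1c).
have -> : barrier c s =
    fun x => c * expR (c^-1 * (japanese_bracket x + cst (- s) x)).
  by apply/funext => x; rewrite /barrier mulrC [c^-1 * _]mulrC mulrC.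
congr (C1_grad _ _): C1d; apply/funext => x.
rewrite addr0 !scalerA [c^-1 * _]mulrC; congr (_ *: _).
by rewrite [c * _]mulrC mulfK.
Qed.

End Barrier.

(** * Solutions in a ball against the solution in the whole space *)

Section StateConstraint.
Context {R : realType} {n : nat}.
Implicit Types (H : 'rV[R]_n -> 'rV[R]_n -> R) (x y p : 'rV[R]_n).

Lemma whole_space_le_state_constraint H (u v : 'rV[R]_n -> R) (r : R) :
  hamiltonian_hyp H -> state_constraint_solution H [set: 'rV[R]_n] u ->
  state_constraint_solution H (eball r) v ->
  forall x, closure (eball r) x -> u x <= v x.
Proof.
move=> HH [usub [uBUC _]] [_ vsup] x vx.
have [lo [hi [colo Hgr]]] := growth_bounds_exist HH.
(* A momentum of norm at least [M] would give [u + H >= 1], against the subsolution inequality. *)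
have [Mu MuP] := BUC_bounded uBUC; have [M MP] := colo (Mu + 1).
rewrite -[u x](subr0 _).
apply: (@comparison _ _ H setT (eball r) u v (cst 0) (cst 0) r M) => //.
- exact: C1_grad_cst.
- by right; exact: closure_eball_le.
- by move=> y z _ /(_ I).
- by move=> y z p _ _ _; rewrite addr0 subr0 => up; split=> //;
    rewrite leNgt; apply/negP => /ltW/MP; have /andP[+ _] := Hgr y p;
    have := MuP y; rewrite closureT ler_norml => /(_ I)/andP[]; lra.
- by rewrite closureT.
Qed.

Lemma growth_constants (lo hi : 'rV[R]_n -> R) : coercive lo ->
  exists2 c : R, 1 <= c & forall H (u v : 'rV[R]_n -> R) (r : R),
    hamiltonian_hyp H -> growth_bounds lo hi H -> 0 <= r ->
    state_constraint_solution H [set: 'rV[R]_n] u ->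
    state_constraint_solution H (eball r) v ->
    forall x, closure (eball r) x ->
      v x <= u x + barrier c (Num.sqrt (1 + r ^+ 2)) x.
Proof.
move=> colo.
(* These constants precede [H]. They will give [u >= - K1] and [v <= - L]; [M] bounds the momenta
   [a] with [v + H a <= 0] where [v >= - K1], and [K2] bounds [H] on the ball of radius [r']. *)
have [K1 K1P] := convex_le_ball hi (@ltr01 R).
have [L LP] := convex_ge hi colo.
have [M MP] := colo (K1 + 1).
(* This ball contains [a - t q] whenever [|a| <= M], [|q| <= 1] and [0 <= t <= 1]. *)
pose r' : R := 2 * `|M| + 2.
have r'0 : 0 < r' by rewrite /r'; have := normr_ge0 M; lra.
have [K2 K2P] := convex_le_ball hi r'0.
(* On the sphere [c] must dominate [K1 - L], the bound on [v - u]; inside the ball it must dominate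
   [K2 - L], the bound on the variation of [H]. *)
pose c := `|K1| + `|K2| + `|L| + 1.
have [K1c K2c Lc] : [/\ K1 <= `|K1|, K2 <= `|K2| & - L <= `|L|].
  by split; rewrite ?ler_norm// -normrN ler_norm.
have c1 : 1 <= c.
  rewrite /c; have := normr_ge0 K1; have := normr_ge0 K2.
  by have := normr_ge0 L; lra.
have c0 : 0 < c by lra.
exists c => // H u v r HH Hgr r0 [_ usup] [vsub [vBUC _]] x vx.
have Hhi y p : H y p <= hi p by have /andP[] := Hgr y p.
have HK1 y p : enorm p <= 1 -> H y p <= K1.
  by move=> p1; apply: (K1P (H y)) => //; exact: hyp_convex.
have HK2 y p : enorm p <= r' -> H y p <= K2.
  by move=> pr; apply: (K2P (H y)) => //; exact: hyp_convex.
have HL y p : - - L <= H y p.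
  rewrite opprK; apply: (LP (H y)); [exact: hyp_convex|exact: Hgr].
have uK1 := supersolution_ge usup HK1.
have vL := subsolution_le (@open_eball _ _ r) vBUC vsub HL.
set s := Num.sqrt (1 + r ^+ 2).
pose E y := expR ((japanese_bracket y - s) / c).
have E0 y : 0 < E y by exact: expR_gt0.
have E1 y : enorm y <= r -> E y <= 1.
  move=> yr; rewrite -expR0 ler_expR pmulr_lle0 ?invr_gt0// subr_le0.
  by rewrite ler_wsqrtr// lerD2l ler_pXn2r// nnegrE enorm_ge0.
have phiE y : barrier c s y = c * E y by [].
suff : v x - barrier c s x <= u x by lra.
apply: (comparison (r := r) (r' := r') HH vsub vBUC usup
  (@C1_grad_barrier _ _ c s (lt0r_neq0 c0))) => //.
- by move=> y; rewrite phiE mulr_ge0 ?ltW.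
- by left; exact: closure_eball_le.
- move=> y z vy /negP; rewrite -leNgt => ry _; have := vL y vy; have := uK1 z.
  suff : c <= barrier c s y by rewrite /c; have := normr_ge0 K2; lra.
  rewrite phiE ler_peMr ?(ltW c0)// -expR0 ler_expR.
  rewrite divr_ge0 ?(ltW c0)// subr_ge0.
  by rewrite ler_wsqrtr// lerD2l ler_pXn2r// nnegrE enorm_ge0.
- move=> y z p vy _ uv; set q := (japanese_bracket y)^-1 *: y.
  rewrite -/(E y); set a := p + E y *: q => va.
  have Ey := E0 y; have Ey1 : E y <= 1 by apply: E1; exact: ltW vy.
  have q1 : enorm q <= 1.
    rewrite enormZ gtr0_norm ?invr_gt0 ?bracket_gt0//.
    by rewrite ler_pdivrMl ?bracket_gt0// mulr1 enorm_le_bracket.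
  (* The inequality is tested only where [v - phi >= u], so the lower bound of [u] passes to [v],
     and coercivity then bounds [a]. *)
  have vyK1 : - K1 <= v y.
    have := uK1 z; suff : 0 <= barrier c s y by lra.
    by rewrite phiE mulr_ge0 ?ltW.
  have aM : enorm a <= M.
    rewrite leNgt; apply/negP => /ltW/MP; have /andP[+ _] := Hgr y a; lra.
  have aMr t : 0 <= t -> t <= 1 -> enorm (a - t *: q) <= r'.
    move=> t0 t1; rewrite enorm_leP ?(ltW r'0)//.
    apply: (le_trans (enorm_sqrB_le _ _)).
    have : enorm a ^+ 2 <= `|M| ^+ 2.
      by rewrite -enorm_leP//; exact: le_trans aM (ler_norm M).
    have : enorm (t *: q) ^+ 2 <= 1 ^+ 2.
      by rewrite -enorm_leP// enormZ ger0_norm// mulr_ile1 ?enorm_ge0.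
    by rewrite /r'; have := normr_ge0 M; nra.
  (* A convex combination, as [0 < E y <= 1]: moving the momentum from [a] to [p] raises [H] by at
     most [E y (H (a - q) - H a)], which the barrier value [c E y] absorbs. *)
  have pE : p = E y *: (a - 1 *: q) + (1 - E y) *: a.
    by rewrite /a; apply/rowP => i; rewrite !mxE; ring.
  split.
    by rewrite -(addrK (E y *: q) p) -/a; apply: aMr => //; exact: ltW.
  have : H y p <= E y * H y (a - 1 *: q) + (1 - E y) * H y a.
    rewrite {1}pE; apply: convex_functionP => //; last exact: ltW.
    exact: hyp_convex.
  have := HK2 y _ (aMr 1 ler01 (lexx _)); have := HL y a.
  rewrite phiE /c; move: (E y) Ey Ey1 => e e0 e1.
  have := normr_ge0 K1; nra.
- by rewrite closureT.
Qed.

(** Since [c >= 1], replacing the bracket by [1 + |x|] and the level by [r] costs at most a factor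
    [e], which goes into the constant [c e]. As [|x| <= r], enlarging the denominator of
    [(|x| - r) / c] to [c e] only raises the exponent. *)
Lemma barrier_le (c r : R) x : 1 <= c -> 0 <= r -> enorm x <= r ->
  barrier c (Num.sqrt (1 + r ^+ 2)) x <=
  (c * expR 1) * expR (enorm x / (c * expR 1)) * expR (- (r / (c * expR 1))).
Proof.
move=> c1 r0 xr; set C := c * expR 1.
have c0 : 0 < c by lra.
have cC : c <= C by rewrite ler_peMr ?(ltW c0)// ltW ?expR_gt1.
rewrite {1}/C -!mulrA -!expRD -mulrBl ler_pM2l// ler_expR.
have jx := bracket_le x.
have rs : r <= Num.sqrt (1 + r ^+ 2).
  by rewrite -{1}(ger0_norm r0) -sqrtr_sqr ler_wsqrtr// lerDr.
apply: (@le_trans _ _ (1 + (enorm x - r) / c)).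
  have -> : 1 + (enorm x - r) / c = (c + (enorm x - r)) / c.
    by rewrite [RHS]mulrDl divff// lt0r_neq0.
  by rewrite ler_pM2r ?invr_gt0//; lra.
rewrite lerD2l ler_wnM2l ?subr_le0// lef_pV2// posrE.
exact: lt_le_trans cC.
Qed.

End StateConstraint.

Theorem theorem1p4 (R : realType) (n : nat) (n_gt0 : (0 < n)%N) :
  (forall (H : 'rV[R]_n -> 'rV[R]_n -> R) (u_ : nat -> 'rV[R]_n -> R)
      (u : 'rV[R]_n -> R),
    hamiltonian_hyp H ->
    (forall k, (0 < k)%N -> state_constraint_solution H (eball k%:R) (u_ k)) ->
    state_constraint_solution H [set: 'rV[R]_n] u ->
    forall k x, (0 < k)%N -> closure (eball k%:R) x -> u x <= u_ k x)
  /\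
  (forall lo hi : 'rV[R]_n -> R, coercive lo ->
    exists2 C : R, 0 < C &
    forall (H : 'rV[R]_n -> 'rV[R]_n -> R) (u_ : nat -> 'rV[R]_n -> R)
      (u : 'rV[R]_n -> R),
    hamiltonian_hyp H -> growth_bounds lo hi H ->
    (forall k, (0 < k)%N -> state_constraint_solution H (eball k%:R) (u_ k)) ->
    state_constraint_solution H [set: 'rV[R]_n] u ->
    (forall k x, (0 < k)%N -> eball k%:R x ->
      u_ k x <= u x + (C * expR (enorm x / C)) * expR (- (k%:R / C)))
    /\
    (forall (r : R) k x, 0 < r -> (0 < k)%N -> r < k%:R ->
      closure (eball r) x ->
      0 <= u_ k x - u x <= (C * expR (r / C)) * expR (- (k%:R / C)))).
Proof.
split=> [H u_ u HH uk uT k x k0|lo hi /(growth_constants hi)[c c1 cP]].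
  exact: whole_space_le_state_constraint HH uT (uk k k0) x.
have C0 : 0 < c * expR 1 by rewrite mulr_gt0 ?expR_gt0//; lra.
exists (c * expR 1) => // H u_ u HH Hgr uk uT.
have bound k x : (0 < k)%N -> eball k%:R x ->
    u_ k x <= u x + (c * expR 1 * expR (enorm x / (c * expR 1))) *
      expR (- (k%:R / (c * expR 1))).
  move=> k0 xk.
  apply: (le_trans (cP _ _ _ _ HH Hgr (ler0n _ _) uT (uk k k0) _ _)).
    exact: subset_closure.
  by rewrite lerD2l; apply: barrier_le => //; exact: ltW.
split=> // r k x r0 k0 rk /closure_eball_le xr.
(* As [r < k], the closed ball of radius [r] lies in the open ball of radius [k], where the
   pointwise bound applies; it increases with [|x| <= r]. *)
have xk : eball k%:R x by exact: le_lt_trans rk.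
rewrite subr_ge0; apply/andP; split.
  exact: (whole_space_le_state_constraint HH uT (uk k k0) (subset_closure xk)).
rewrite lerBlDl; apply: (le_trans (bound k x k0 xk)).
rewrite lerD2l ler_wpM2r ?expR_ge0// ler_pM2l// ler_expR.
by rewrite ler_pM2r ?invr_gt0.
Qed.
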